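(* Let $n\in\mathbb{N}\setminus\{1,2\}$ and let $\Lambda_n(t,W)\in\mathcal{M}(\mathcal{O}_n)$ be a cyclotomic model set. Then: (a) The set $\mathcal{F}(\Lambda_n(t,W))$ is successively determined by two $X$-rays in $\mathcal{O}_n$-directions. (b) The set $\mathcal{F}(\Lambda_n(t,W))$ is successively determined by two projections on orthogonal complements of $1$-dimensional $\mathcal{O}_n$-subspaces.
   Context: Identify $\mathbb{C}$ with $\mathbb{R}^2$. Let $\zeta_n=e^{2\pi i/n}$, $\mathbb{K}_n=\mathbb{Q}(\zeta_n)$, $\mathcal{O}_n=\mathbb{Z}[\zeta_n]$, and let $\phi$ be Euler's totient function. Cyclotomic model sets. For $n\in\mathbb{N}\setminus\{1,2\}$, choose exactly one automorphism from each pair of complex conjugate automorphisms in $\mathrm{Gal}(\mathbb{K}_n/\mathbb{Q})$, obtaining $\sigma_1=\mathrm{id},\sigma_2,\dots,\sigma_{\phi(n)/2}$. The associated star map $\star:\mathcal{O}_n\to(\mathbb{R}^2)^{\phi(n)/2-1}$ is $z\mapsto(\sigma_2(z),\dots,\sigma_{\phi(n)/2}(z))$; if $n\in\{3,4,6\}$, $(\mathbb{R}^2)^{0}$ is the trivial group $\{0\}$ and the star map is $0$. A window is a set $W\subset(\mathbb{R}^2)^{\phi(n)/2-1}$ with $\varnothing\neq W^\circ\subset W\subset\overline{W^\circ}$ and $\overline{W^\circ}$ compact. For a window $W$ and $t\in\mathbb{R}^2$ set $\Lambda_n(t,W)=t+\{z\in\mathcal{O}_n : z^\star\in W\}$. $\mathcal{M}(\mathcal{O}_n)$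 is the collection of all sets $\Lambda_n(t,W)$ (all $t$, all windows $W$, all choices of star map); its elements are called cyclotomic model sets. $\mathcal{F}(S)$ denotes the set of all finite subsets of $S\subset\mathbb{R}^2$. A direction is an element of $\mathbb{S}^1$; an $\mathcal{O}_n$-direction is a direction parallel to a non-zero element of $\mathcal{O}_n$; a $1$-dimensional $\mathcal{O}_n$-subspace is a line $\mathbb{R}o$ with $o\in\mathcal{O}_n\setminus\{0\}$. For a finite $F\subset\mathbb{R}^2$ and a direction $u$, the $X$-ray $X_uF$ is the function assigning to each line $\ell$ parallel to $u$ the number $\operatorname{card}(F\cap\ell)$. $F|T^\perp$ denotes the orthogonal projection (canonical inner product) of $F$ on $T^\perp$. A collection $\mathcal{E}$ of finite subsets of $\mathbb{R}^2$ is successively determined by $m$ $X$-rays in $\mathcal{O}_n$-directions if, for a given $F\in\mathcal{E}$, pairwise non-parallel $\mathcal{O}_n$-directions $u_1,\dots,u_m$ can be chosen inductively (the choice of $u_j$ depending on the $X$-rays $X_{u_k}F$, $k\in\{1,\dots,j-1\}$) such that for all $F'\in\mathcal{E}$: $(X_{u_j}F'=X_{u_j}F\ \forall j\in\{1,\dots,m\})\Rightarrow F'=F$. It is successively determined by $m$ projections on orthogonal complements of $1$-dimensional $\mathcal{O}_n$-subspaces if, for a given $F\in\mathcal{E}$, pairwise non-parallel $1$-dimensional $\mathcal{O}_n$-subspaces $T_1,\dots,T_m$ can be chosen inductively (the choice of $T_j$ depending on the projections $F|T_k^\perp$, $k\in\{1,\dots,j-1\}$) such that for all $F'\in\mathcal{E}$: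 $(F'|T_j^\perp=F|T_j^\perp\ \forall j\in\{1,\dots,m\})\Rightarrow F'=F$. *)

(* Defs.v *)
(* The Euclidean plane is identified with the field of complex numbers R[i],
   where R is any realType. *)
From HB Require Import structures.
From mathcomp Require Import all_boot all_order all_algebra.
From mathcomp Require Import finmap complex.
From mathcomp Require Import all_classical all_reals all_analysis.

Set Implicit Arguments.
Unset Strict Implicit.
Unset Printing Implicit Defensive.

Import Order.TTheory GRing.Theory Num.Theory.
Import numFieldNormedType.Exports.

Local Open Scope fset_scope.
Local Open Scope classical_set_scope.
Local Open Scope ring_scope.
Local Open Scope complex_scope.

Section Plane.
Variable R : realType.
Implicit Types (x y p u v o : R[i]) (F S T : set R[i]).

Definition inner x y : R := complex.Re x * complex.Re y + complex.Im x * complex.Im y.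

Definition line p u : set R[i] := [set p + r%:C * u | r in [set: R]].

Definition parallel_dir u v : Prop := exists2 r : R, r != 0 & v = r%:C * u.

Definition direction u : Prop := inner u u = 1.

Definition line_along u : Type := {l : set R[i] | exists p, l = line p u}.

Definition Xray u F : line_along u -> nat :=
  fun l => #|` fset_set (F `&` sval l)|.

Definition orth T : set R[i] := [set y | forall x, T x -> inner x y = 0].

(* Image of F under the orthogonal projection onto a linear subspace S: the
   projection of x is the element y of S such that x - y is orthogonal to S. *)
Definition oproj S F : set R[i] :=
  [set y | S y /\ exists2 x, F x & orth S (x - y)].

Definition parallel_flat T T' : Prop := exists v, T' = [set v + x | x in T].

Definition finite_subsets S : set (set R[i]) :=
  [set F | finite_set F /\ F `<=` S].

End Plane.

(* The choice of the next query may depend only on the list of the earlier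
   queries and of the answers they received, oldest first. An answer to the
   query d has a type Y d depending on d, hence the sigma type. *)
Fixpoint history (D : Type) (Y : D -> Type) (strategy : seq {d : D & Y d} -> D)
    (answer : forall d, Y d) (j : nat) : seq {d : D & Y d} :=
  if j is k.+1 then
    let h := history strategy answer k in
    rcons h (existT Y (strategy h) (answer (strategy h)))
  else [::].

(* A single strategy serves the whole collection E; along its run on F, the
   j-th query (counted from 0) is u j. *)
Definition successively_determined (R : realType) (D : Type) (Y : D -> Type)
    (admissible : set D) (parallel : D -> D -> Prop)
    (obs : forall d, set R[i] -> Y d) (m : nat) (E : set (set R[i])) : Prop :=
  exists strategy : seq {d : D & Y d} -> D, forall F, E F ->
    let u j := strategy (history strategy (fun d => obs d F) j) in
    [/\ forall j, (j < m)%N -> admissible (u j),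
        forall j k, (j < k)%N -> (k < m)%N -> ~ parallel (u j) (u k)
      & forall F', E F' ->
          (forall j, (j < m)%N -> obs (u j) F' = obs (u j) F) -> F' = F].

Section Cyclotomic.
Variables (R : realType) (n : nat).

Definition zeta : R[i] := cos (2 * pi / n%:R) +i* sin (2 * pi / n%:R).

Definition cyclo_field : set R[i] :=
  [set z | exists p q : {poly rat}, (map_poly ratr q).[zeta] != 0 /\
     z = (map_poly ratr p).[zeta] / (map_poly ratr q).[zeta]].

Definition cyclo_int : set R[i] :=
  [set z | exists p : {poly int}, z = (map_poly intr p).[zeta]].

(* An element of the Galois group is represented by any function on R[i]
   restricting to it: the values outside cyclo_field are irrelevant, and
   equality of automorphisms is equality on cyclo_field. *)
Definition cyclo_aut (s : R[i] -> R[i]) : Prop :=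
  [/\ set_bij cyclo_field cyclo_field s,
      forall x y, cyclo_field x -> cyclo_field y -> s (x + y) = s x + s y,
      forall x y, cyclo_field x -> cyclo_field y -> s (x * y) = s x * s y
    & forall q : rat, s (ratr q) = ratr q].

(* For n >= 3 the totient of n is even and positive, so this is really
   phi(n)/2 - 1. *)
Definition codim : nat := (totient n)./2.-1.

(* s lists sigma_1 = id, ..., sigma_(phi(n)/2); every automorphism tau has
   exactly one of tau, conj tau in the list. *)
Definition conj_transversal (s : 'I_codim.+1 -> R[i] -> R[i]) : Prop :=
  [/\ forall i, cyclo_aut (s i),
      forall z, cyclo_field z -> s ord0 z = z
    & forall tau, cyclo_aut tau ->
        exists! i, (forall z, cyclo_field z -> s i z = tau z) \/
                   (forall z, cyclo_field z -> s i z = conjc (tau z))].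

(* The internal space (R^2)^codim is the space of codim x 2 matrices with its
   product topology; row i is the (i+2)-nd conjugate as a point of R^2. *)
Definition star (s : 'I_codim.+1 -> R[i] -> R[i]) (z : R[i]) : 'M[R]_(codim, 2) :=
  \matrix_(i, j) let w := s (lift ord0 i) z in if j == 0 then complex.Re w else complex.Im w.

Definition window (W : set 'M[R]_(codim, 2)) : Prop :=
  [/\ W° !=set0, W `<=` closure W° & compact (closure W°)].

Definition model_set s (t : R[i]) (W : set 'M[R]_(codim, 2)) : set R[i] :=
  [set t + z | z in [set z | cyclo_int z /\ W (star s z)]].

Definition cyclotomic_model_sets : set (set R[i]) :=
  [set L | exists s t W,
     [/\ conj_transversal s, window W & L = model_set s t W]].

Definition cyclo_direction (u : R[i]) : Prop :=
  direction u /\ exists o, [/\ cyclo_int o, o != 0 & parallel_dir o u].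

Definition cyclo_subspace (T : set R[i]) : Prop :=
  exists o, [/\ cyclo_int o, o != 0 & T = line 0 o].

Definition determined_by_Xrays (m : nat) (E : set (set R[i])) : Prop :=
  successively_determined cyclo_direction (@parallel_dir R) (@Xray R) m E.

Definition determined_by_projections (m : nat) (E : set (set R[i])) : Prop :=
  successively_determined cyclo_subspace (@parallel_flat R)
    (fun T F => oproj (orth T) F) m E.

End Cyclotomic.

(* Main.v *)
Require Import Defs.
From mathcomp Require Import all_boot all_order all_algebra.
From mathcomp Require Import complex.
From mathcomp Require Import all_classical all_reals all_analysis.
From mathcomp Require Import algC algnum finmap ring lra.

(** A model set is a translate of a subset of Z[zeta], so the difference of any two
    of its points is an algebraic integer. This lets two queries separate its
    finite subsets.

    The first query uses the real direction 1. Its answer shows which horizontal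
    lines meet F, so the difference d of two points of sets F1, F2 compatible
    with that answer has its imaginary part in a finite set known in advance,
    although the points themselves range over an infinite set.

    The second query uses v = 1 + N zeta for a suitable N > 0. If F1 and F2 give
    the same answer again, every x1 in F1 is joined by a line parallel to v to
    some x2 in F2, so d = x1 - x2 = r v with r real. The parameter r can be
    eliminated [collinear_conjc_multiple]: with z' the conjugate of z,
      d - d' = N (d' zeta - d zeta'),
    and the factor of N is an algebraic integer. But d - d' = 2 i Im d takes
    only finitely many values, and a nonzero algebraic integer is not N times an
    algebraic integer once N is large [integral_not_multiple]. Hence N can be
    chosen, from the first answer alone, so that Im d = 0 is forced. Then r = 0,
    as v is not real, and x1 = x2. So F1 is contained in F2, and by symmetry
    F1 = F2 [exists_separating_multiple].

    The argument reads off an X-ray which lines of its direction meet the set, and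
    a projection tells the same. Both parts are therefore instances of one
    statement about the relation [shadowed], [determined_by_two_shadows]. *)

(** * Divisibility among algebraic integers *)

Section IntegralDivisibility.
Set Implicit Arguments.
Unset Strict Implicit.
Import Order.TTheory GRing.Theory Num.Theory.
Local Open Scope classical_set_scope.
Local Open Scope ring_scope.
Variable K : numFieldType.

(** A rational algebraic integer is an integer. An arbitrary [K] does not embed in
    [algC], but [rat] embeds in both: the root is moved through [rat], to use the
    algebraic integers of [algC]. *)
Lemma integral_quotient_dvd (m : int) (N : nat) :
  (0 < N)%N -> integralOver (intr : int -> K) (m%:~R / N%:R) -> (N %| m)%Z.
Proof.
move=> N_gt0 [p p_monic p_root].
have N_neq0 (F : numFieldType) : N%:R != 0 :> F by rewrite pnatr_eq0 -lt0n.
pose q : rat := m%:~R / N%:R.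
have qE (F : numFieldType) : ratr q = m%:~R / N%:R :> F.
  by rewrite /q fmorph_div rmorph_int rmorph_nat.
have pE (F : numFieldType) :
    map_poly intr p = map_poly ratr (map_poly intr p) :> {poly F}.
  by rewrite -map_poly_comp; apply: eq_map_poly => x /=; rewrite ratr_int.
have q_root : root (map_poly intr p) q by rewrite -(fmorph_root (@ratr K)) -pE /= qE.
have q_Aint : (ratr q : algC) \in Aint.
  apply: (@root_monic_Aint (map_poly intr p)).
  - by rewrite pE fmorph_root.
  - exact: monic_map.
  - by apply/polyOverP => i; rewrite coef_map /= rpred_int.
have /intrP[k kE] := Cint_rat_Aint (Crat_rat q) q_Aint.
apply/dvdzP; exists k; apply/eqP; rewrite -(eqr_int algC); apply/eqP.
by rewrite intrM -kE qE -pmulrn divfK ?N_neq0.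
Qed.

(** If z is a root of q with constant term m != 0, then z g(z) = - m for an
    integer polynomial g. So z = N e makes m / N = - g(z) e an algebraic
    integer, which forces N to divide m and bounds N by |m|. *)
Lemma integral_not_multiple (z : K) : z != 0 -> integralOver (intr : int -> K) z ->
  \forall N \near \oo, forall e, integralOver (intr : int -> K) e -> z != N%:R * e.
Proof.
move=> z_neq0 [p p_monic p_root].
(* Remove the factors 'X of p, to get a nonzero constant term. *)
have [k [q]] := multiplicity_XsubC p 0; rewrite monic_neq0 //= => q0 pE.
have q_root : root (map_poly (intr : int -> K) q) z.
  move: p_root; rewrite pE rmorphM rmorphXn /= rmorphB /= map_polyX map_polyC /=.
  rewrite subr0 rootM => /orP[//|].
  by rewrite rootE hornerXn expf_eq0 (negPf z_neq0) andbF.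
have [g gE] : exists g : {poly int}, q = g * 'X + (q`_0)%:P.
  by exists (Poly (behead q)); apply/polyP => -[|i];
     rewrite coefD coefMX coefC /= ?add0r ?addr0 // coef_Poly nth_behead.
have m_neq0 : q`_0 != 0 by rewrite -horner_coef0.
near=> N => e e_int; apply/eqP => zE.
have N_gt0 : (0 < N)%N by near: N; exact: nbhs_infty_gt.
have : (N %| q`_0)%Z.
  apply: integral_quotient_dvd => //.
  have -> : (q`_0)%:~R / N%:R = - ((map_poly intr g).[z] * e) :> K.
    apply: (canLR (mulfK _)); first by rewrite pnatr_eq0 -lt0n.
    move: q_root; rewrite rootE {1}gE rmorphD rmorphM /= map_polyX map_polyC /=.
    by rewrite !hornerE addrC addr_eq0 => /eqP ->; rewrite {2}zE; ring.
  apply: integral_opp; apply: integral_mul => //; apply: integral_horner.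
    by apply/integral_poly => i; rewrite coef_map /=; exact: integral_id.
  rewrite zE; apply: integral_mul => //; exact: integral_nat.
rewrite /dvdz => /dvdn_leq; rewrite absz_gt0 m_neq0 => /(_ isT).
apply/negP; rewrite -ltnNge; near: N; exact: nbhs_infty_gt.
Unshelve. all: by end_near.
Qed.

End IntegralDivisibility.

(** * Strategies with two queries *)

Section TwoQueries.
Set Implicit Arguments.
Unset Strict Implicit.
Import Order.TTheory GRing.Theory Num.Theory.
Local Open Scope classical_set_scope.

(** A single strategy must serve every set of the collection, so the second query
    has to be chosen from the answer to the first one. This is possible because
    the hypothesis on d mentions F only through [obs d0 F]. *)
Lemma successively_determined2 (R : realType) (D : Type) (Y : D -> Type)
    (admissible : set D) (parallel : D -> D -> Prop)
    (obs : forall d, set (complex R) -> Y d) (E : set (set (complex R))) (d0 : D) :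
  admissible d0 ->
  (forall F, E F -> exists d, [/\ admissible d, ~ parallel d0 d &
    forall F1 F2, E F1 -> E F2 -> obs d0 F1 = obs d0 F -> obs d0 F2 = obs d0 F ->
      obs d F1 = obs d F2 -> F1 = F2]) ->
  successively_determined admissible parallel obs 2 E.
Proof.
move=> adm0 second.
pose separates (q : {d : D & Y d}) d := [/\ admissible d, ~ parallel d0 d &
  forall F1 F2, E F1 -> E F2 ->
    obs (projT1 q) F1 = projT2 q -> obs (projT1 q) F2 = projT2 q ->
    obs d F1 = obs d F2 -> F1 = F2].
pose strategy (h : seq {d : D & Y d}) :=
  if h is q :: _ then
    if pselect (exists d, separates q d) is left ex then projT1 (cid ex) else d0
  else d0.
exists strategy => F EF u.
have [adm1 npar sep] : separates (existT Y d0 (obs d0 F)) (u 1%N).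
  by rewrite /u /=; case: pselect => [ex|/(_ (second F EF))//]; case: cid.
split=> [[|[|//]] // _|[|j] [|[|k]] //|F' EF' same].
by apply: sep => //; [exact: (same 0%N)|exact: (same 1%N)].
Qed.

End TwoQueries.

(** * Sets with the same image along a direction *)

Section Shadows.
Set Implicit Arguments.
Unset Strict Implicit.
Import Order.TTheory GRing.Theory Num.Theory.
Local Open Scope classical_set_scope.
Local Open Scope ring_scope.
Local Open Scope complex_scope.
Variable R : realType.
Local Notation Im := complex.Im.
Local Notation algebraic_integer := (integralOver (intr : int -> R[i])).
Implicit Types (F L : set R[i]) (o u v x y z theta : R[i]).

(** Inclusion of the images of F and F' in the quotient of the plane by the line
    R v. *)
Definition shadowed v F F' : Prop :=
  forall x, F x -> exists2 x', F' x' & exists r : R, x - x' = r%:C * v.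

Lemma integral_conjc z : algebraic_integer z -> algebraic_integer z^*.
Proof.
move=> [p p_monic p_root]; exists p => //.
have -> : map_poly intr p = map_poly conjc (map_poly intr p) :> {poly R[i]}.
  by rewrite -map_poly_comp; apply: eq_map_poly => k /=; rewrite rmorph_int.
by rewrite fmorph_root.
Qed.

Lemma subcJ_addr z (r : R) : (z + r%:C) - (z + r%:C)^* = z - z^*.
Proof.
case: z => a b; apply/eqP; rewrite eq_complex /=.
by apply/andP; split; apply/eqP; ring.
Qed.

(** With conjugates written as primes, both sides equal r N (theta - theta'): in
    z' theta - z theta' the terms in N cancel. *)
Lemma collinear_conjc_multiple theta (N : nat) (r : R) z :
  z = r%:C * (1 + N%:R * theta) ->
  z - z^* = N%:R * (z^* * theta - z * theta^*).
Proof.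
have -> : (N%:R : R[i]) = (N%:R : R)%:C by rewrite rmorph_nat.
move=> ->; case: theta => a b.
by apply/eqP; rewrite eq_complex /=; apply/andP; split; apply/eqP; ring.
Qed.

(** The integer N depends on F alone and must avoid finitely many divisibility
    relations, one for each pair of points of F at different heights. All large N
    do so. *)
Lemma exists_separating_multiple theta L F :
  algebraic_integer theta -> Im theta != 0 ->
  (forall x y, L x -> L y -> algebraic_integer (x - y)) ->
  finite_set F -> F `<=` L ->
  exists2 N : nat, (0 < N)%N & forall F1 F2, F1 `<=` L -> F2 `<=` L ->
    shadowed 1 F1 F -> shadowed 1 F2 F ->
    shadowed (1 + N%:R * theta) F1 F2 -> F1 `<=` F2.
Proof.
move=> theta_int Im_theta L_int finF FL.
(* Twice the imaginary unit times the difference of heights, an algebraic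
   integer. *)
pose jump (p : R[i] * R[i]) := (p.1 - p.2) - (p.1 - p.2)^*.
pose good (p : R[i] * R[i]) : set nat := [set N | jump p = 0 \/
   forall e, algebraic_integer e -> jump p != N%:R * e].
have [N [N_gt0 goodN]] : exists N : nat, (0 < N)%N /\ forall p, (F `*` F) p -> good p N.
  suff : \forall N \near \oo, (0 < N)%N /\ forall p, (F `*` F) p -> good p N.
    by move=> /filter_ex.
  near=> N; split; first by near: N; exact: nbhs_infty_gt.
  near: N; have /finite_fsetP[X XE] := finite_setX finF finF.
  rewrite XE; apply: filter_bigI => p pX.
  have [F1 F2] : (F `*` F) p by rewrite XE.
  have [j0|jN0] := eqVneq (jump p) 0; first by near=> N; left.
  have p_int : algebraic_integer (p.1 - p.2) by apply: L_int; exact: FL.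
  have j_int : algebraic_integer (jump p).
    by apply: integral_sub => //; exact: integral_conjc.
  by apply: filterS (integral_not_multiple jN0 j_int) => N; right.
exists N => // F1 F2 F1L F2L sh1 sh2 sh x1 F1x1.
have [x2 F2x2 [r x12E]] := sh x1 F1x1.
(* y1 and y2 are points of F at the heights of x1 and x2. *)
have [y1 Fy1 [r1 xy1E]] := sh1 x1 F1x1.
have [y2 Fy2 [r2 xy2E]] := sh2 x2 F2x2.
have jE : jump (y1, y2) = (x1 - x2) - (x1 - x2)^*.
  have -> : x1 - x2 = (y1 - y2) + (r1 - r2)%:C.
    by rewrite rmorphB /= -[r1%:C]mulr1 -[r2%:C]mulr1 -xy1E -xy2E; ring.
  by rewrite subcJ_addr.
have x12_int : algebraic_integer (x1 - x2) by apply: L_int; [exact: F1L|exact: F2L].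
suff r0 : r = 0 by move: x12E; rewrite r0 mul0r => /subr0_eq ->.
have [j0|nj] := goodN (y1, y2) (conj Fy1 Fy2).
  have : Im (x1 - x2) = 0.
    move: j0; rewrite jE => /(congr1 (@complex.Im R)); case: (x1 - x2) => a b /=.
    by lra.
  have NE : (N%:R : R[i]) = (N%:R : R)%:C by rewrite rmorph_nat.
  rewrite x12E NE; case: (theta) Im_theta => a b /= b0 h.
  have /eqP : r * (N%:R * b) = 0 by rewrite -h; ring.
  by rewrite !mulf_eq0 (negPf b0) pnatr_eq0 -[N == 0%N]negbK -lt0n N_gt0 !orbF => /eqP.
case/negP: (nj _ (integral_sub
  (integral_mul (integral_conjc x12_int) theta_int)
  (integral_mul x12_int (integral_conjc theta_int)))).
by rewrite jE {1}(collinear_conjc_multiple x12E).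
Unshelve. all: by end_near.
Qed.

End Shadows.

(** * Cyclotomic integers, X-rays and projections *)

Section Cyclotomic.
Set Implicit Arguments.
Unset Strict Implicit.
Import Order.TTheory GRing.Theory Num.Theory.
Local Open Scope classical_set_scope.
Local Open Scope ring_scope.
Local Open Scope complex_scope.
Variable R : realType.
Variable n : nat.
Hypothesis n_gt2 : (2 < n)%N.
Local Notation Re := complex.Re.
Local Notation Im := complex.Im.
Local Notation algebraic_integer := (integralOver (intr : int -> R[i])).
Local Notation zeta := (@zeta R n).
Local Notation cyclo_int := (@cyclo_int R n).
Implicit Types (F L T : set R[i]) (o u v x y z : R[i]).

Lemma ImD x y : Im (x + y) = Im x + Im y.
Proof. by case: x y => [a b] [c d]. Qed.

Lemma ImZ (r : R) z : Im (r%:C * z) = r * Im z.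
Proof. by case: z => a b /=; ring. Qed.

Lemma zeta_expn : zeta ^+ n = 1.
Proof.
have moivre (a : R) (k : nat) :
    (cos a +i* sin a) ^+ k = cos (a *+ k) +i* sin (a *+ k) :> R[i].
  elim: k => [|k IH]; first by rewrite expr0 mulr0n cos0 sin0.
  rewrite exprS IH mulrS cosD sinD.
  by apply/eqP; rewrite eq_complex /=; apply/andP; split; apply/eqP; ring.
rewrite moivre -[_ *+ n]mulr_natr divfK; last by rewrite pnatr_eq0; case: n n_gt2.
by rewrite mulr_natl cos2pi sin2pi.
Qed.

Lemma Im_zeta_gt0 : 0 < Im zeta.
Proof.
have n_gt0 : (0 : R) < n%:R by rewrite ltr0n; case: n n_gt2.
rewrite /= sin_gt0_pi // divr_gt0 ?mulr_gt0 ?pi_gt0 //=.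
by rewrite ltr_pdivrMr // mulrC ltr_pM2l ?pi_gt0 // ltr_nat.
Qed.

Lemma algebraic_integer_zeta : algebraic_integer zeta.
Proof.
exists ('X^n - 1%:P); first by apply: monicXnsubC; case: n n_gt2.
by rewrite rmorphB /= map_polyXn map_polyC rmorph1 /root !hornerE zeta_expn subrr.
Qed.

Lemma cyclo_int_integral z : cyclo_int z -> algebraic_integer z.
Proof.
move=> [p ->]; apply: integral_horner; last exact: algebraic_integer_zeta.
by apply/integral_poly => i; rewrite coef_map /=; exact: integral_id.
Qed.

Lemma cyclo_int1 : cyclo_int 1.
Proof. by exists 1; rewrite rmorph1 hornerC. Qed.

Lemma cyclo_int_1DNzeta (N : nat) : cyclo_int (1 + N%:R * zeta).
Proof.
exists (1 + N%:R * 'X).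
by rewrite rmorphD rmorphM rmorph1 rmorph_nat /= map_polyX -polyC_natr !hornerE.
Qed.

Lemma Im_1DNzeta (N : nat) : (0 < N)%N -> Im (1 + N%:R * zeta) != 0.
Proof.
move=> N_gt0; have -> : (N%:R : R[i]) = (N%:R : R)%:C by rewrite rmorph_nat.
rewrite ImD ImZ add0r.
by rewrite mulf_neq0 ?pnatr_eq0 -?lt0n // gt_eqF // Im_zeta_gt0.
Qed.

(** Common form of the two parts: [query o] stands for the unit direction of o in
    one, for the line spanned by o in the other. *)
Lemma determined_by_two_shadows (D : Type) (Y : D -> Type)
    (admissible : set D) (parallel : D -> D -> Prop)
    (obs : forall d, set R[i] -> Y d) (query : R[i] -> D) L :
  (forall x y, L x -> L y -> algebraic_integer (x - y)) ->
  (forall o, cyclo_int o -> o != 0 -> admissible (query o)) ->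
  (forall v, Im v != 0 -> ~ parallel (query 1) (query v)) ->
  (forall o F F', o != 0 -> finite_set F -> finite_set F' ->
     obs (query o) F = obs (query o) F' -> shadowed o F F') ->
  successively_determined admissible parallel obs 2 (finite_subsets L).
Proof.
move=> L_int adm npar shadow; apply: (successively_determined2 (d0 := query 1)).
  by apply: adm; [exact: cyclo_int1|exact: oner_neq0].
move=> F [finF FL].
have Im_zeta0 : Im zeta != 0 by rewrite gt_eqF ?Im_zeta_gt0.
have [N N_gt0 sep] :=
  exists_separating_multiple algebraic_integer_zeta Im_zeta0 L_int finF FL.
have Im_v := Im_1DNzeta N_gt0; set v := 1 + _ in sep Im_v.
have v_neq0 : v != 0 by apply: contraNneq Im_v => ->.
exists (query v); split; [by apply: adm => //; exact: cyclo_int_1DNzeta|exact: npar|].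
have one0 := oner_neq0 R[i].
move=> F1 F2 [fin1 F1L] [fin2 F2L] e1 e2 e.
have s1 := shadow 1 F1 F one0 fin1 finF e1.
have s2 := shadow 1 F2 F one0 fin2 finF e2.
apply/seteqP; split; apply: sep => //; exact: shadow.
Qed.

(** A point x of F makes the X-ray positive on the line through x, so that F' meets
    this line. *)
Lemma Xray_shadowed u F F' : finite_set F -> finite_set F' ->
  @Xray R u F = @Xray R u F' -> shadowed u F F'.
Proof.
move=> finF finF' eqX x Fx.
pose l : line_along u := exist _ (line x u) (ex_intro _ x erefl).
have : (0 < @Xray R u F' l)%N.
  rewrite -eqX /Xray cardfs_gt0; apply: contraPneq Fx.
  move=> /fset_set_set0 => /(_ (finite_setIl _ finF)) /seteqP[+ _] Fx.
  by move=> /(_ x); apply; split => //; exists 0 => //; rewrite mul0r addr0.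
rewrite /Xray cardfs_gt0 => /fset0Pn[x']; rewrite in_fset_set; last exact: finite_setIl.
move=> /set_mem[F'x' [r _ x'E]]; exists x' => //; exists (- r).
by rewrite -x'E rmorphN; ring.
Qed.

Lemma shadowedZ (r : R) v F F' : shadowed (r%:C * v) F F' -> shadowed v F F'.
Proof.
move=> sh x /sh[x' F'x' [s xx'E]]; exists x' => //; exists (s * r).
by rewrite xx'E rmorphM mulrA.
Qed.

Lemma inner_gt0 o : o != 0 -> 0 < inner o o.
Proof.
case: o => a b; rewrite eq_complex /inner /= negb_and => ab.
rewrite lt_neqAle eq_sym -!expr2 addr_ge0 ?sqr_ge0 // andbT paddr_eq0 ?sqr_ge0 //.
by rewrite !sqrf_eq0 negb_and.
Qed.

Definition unit_vector o : R[i] := (Num.sqrt (inner o o))^-1%:C * o.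

Lemma determined_by_two_Xrays L :
  (forall x y, L x -> L y -> algebraic_integer (x - y)) ->
  @determined_by_Xrays R n 2 (finite_subsets L).
Proof.
move=> L_int; apply: (determined_by_two_shadows (query := unit_vector)) => //.
- move=> o o_int o_neq0; split; last first.
    exists o; split=> //; exists (Num.sqrt (inner o o))^-1 => //.
    by rewrite invr_neq0 // sqrtr_eq0 -ltNge inner_gt0.
  rewrite /direction /unit_vector; set s := Num.sqrt _.
  have -> : inner (s^-1%:C * o) (s^-1%:C * o) = s ^- 2 * inner o o.
    by rewrite /inner /=; case: (o) => a b /=; rewrite -exprVn; ring.
  by rewrite /s sqr_sqrtr ?mulVf ?gt_eqF ?ltW // inner_gt0.
- move=> v Im_v [r r_neq0]; rewrite /unit_vector.
  set s := Num.sqrt _; set s1 := Num.sqrt _.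
  have s_neq0 : s != 0.
    by rewrite sqrtr_eq0 -ltNge inner_gt0 //; apply: contraNneq Im_v => ->.
  move=> /(congr1 (@complex.Im R)); rewrite !ImZ /= !mulr0 => /eqP.
  by apply/negP; rewrite mulf_neq0 ?invr_neq0.
- move=> o F F' _ finF finF' eqX; apply: (shadowedZ (r := (Num.sqrt (inner o o))^-1)).
  exact: Xray_shadowed.
Qed.

(** Since i o lies in the orthogonal complement of R o, x is orthogonal to i o. The
    coefficient is that of the orthogonal projection of x on R o. *)
Lemma orth_orth_line o x : o != 0 ->
  orth (orth (line 0 o)) x -> exists r : R, x = r%:C * o.
Proof.
move=> o_neq0 /(_ (- Im o +i* Re o)) ox.
have oo := inner_gt0 o_neq0.
exists (inner x o / inner o o).
have {}ox : inner (- Im o +i* Re o) x = 0.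
  by apply: ox => _ [r _ <-]; rewrite /inner; case: (o) => a b /=; ring.
move: ox oo; rewrite /inner; case: (x) (o) => [a b] [c d] /= ox oo.
have oo_neq0 : c * c + d * d != 0 by rewrite gt_eqF.
apply/eqP; rewrite eq_complex /= !mul0r subr0 addr0; apply/andP.
split; apply/eqP; rewrite mulrAC; apply: (canRL (mulfK oo_neq0)); apply/subr0_eq.
  by rewrite -[RHS](mulr0 (- d)) -ox; ring.
by rewrite -[RHS](mulr0 c) -ox; ring.
Qed.

Lemma oproj_shadowed o F F' : o != 0 ->
  oproj (orth (line 0 o)) F = oproj (orth (line 0 o)) F' -> shadowed o F F'.
Proof.
move=> o_neq0 eqP_ x Fx; have oo := inner_gt0 o_neq0.
pose k := inner x o / inner o o; pose y := x - k%:C * o.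
have : oproj (orth (line 0 o)) F y.
  split; last first.
    exists x => // z z_orth; rewrite opprB addrC subrK.
    rewrite -(z_orth (k%:C * o)); last by exists k => //; rewrite add0r.
    by rewrite /inner; ring.
  move=> _ [r _ <-]; rewrite add0r.
  have -> : inner (r%:C * o) y = r * (inner x o - k * inner o o).
    by rewrite /y /inner; case: (x) (o) => [a b] [c d] /=; ring.
  by rewrite /k divfK ?gt_eqF // subrr mulr0.
rewrite eqP_ => -[_ [x' F'x' /(orth_orth_line o_neq0)[r x'yE]]].
exists x' => //; exists (k - r); rewrite rmorphB mulrBl -x'yE /y; ring.
Qed.

Lemma determined_by_two_projections L :
  (forall x y, L x -> L y -> algebraic_integer (x - y)) ->
  @determined_by_projections R n 2 (finite_subsets L).
Proof.
move=> L_int; apply: (determined_by_two_shadows (query := line 0)) => //.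
- by move=> o o_int o_neq0; exists o.
- (* A translate w + R of the real line has constant height Im w, whereas R v
     contains 0 and v. *)
  move=> v Im_v [w lineE].
  have Im_w (r : R) : line 0 v (r%:C * v) -> r * Im v = Im w.
    rewrite lineE => -[_ [s _ <-]] /(congr1 (@complex.Im R)).
    by rewrite ImD add0r !ImZ mulr0 addr0.
  have [i0 i1] : 0 * Im v = Im w /\ 1 * Im v = Im w.
    by split; apply: Im_w; eexists=> //; rewrite add0r.
  by move: Im_v; rewrite -[Im v]mul1r i1 -i0 mul0r eqxx.
- by move=> o F F' o_neq0 _ _; exact: oproj_shadowed.
Qed.

End Cyclotomic.

Theorem corollary15 (R : realType) (n : nat) (hn : (2 < n)%N)
    (Lambda : set R[i]%C) (hLambda : @cyclotomic_model_sets R n Lambda) :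
  @determined_by_Xrays R n 2 (finite_subsets Lambda) /\
  @determined_by_projections R n 2 (finite_subsets Lambda).
Proof.
have Lambda_int x y : Lambda x -> Lambda y ->
    integralOver (intr : int -> R[i]%C) (x - y)%R.
  case: hLambda => s [t [W [_ _ ->]]] [a [a_int _] <-] [b [b_int _] <-].
  have -> : ((t + a) - (t + b) = a - b)%R by ring.
  by apply: integral_sub; apply: (cyclo_int_integral hn).
by split; [exact: determined_by_two_Xrays|exact: determined_by_two_projections].
Qed.
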